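(* For a token-exchangeable topic model on $\widetilde{\mathcal V}$, on the set of $\boldsymbol\theta$ with $0<e(\boldsymbol\theta)<1$ one has $\Phi=g\circ(e,\sigma)$ with $g(u,z)=a(1-u)/u+bz/(1-u)+c$, where $\Phi(\boldsymbol\theta)$ is the almost sure limit of $\mathrm{FKGL}_N$ as $N\to\infty$ given $\boldsymbol\theta$. Hence $\Phi(\boldsymbol\theta)=\Phi(\boldsymbol\theta')$ whenever $e(\boldsymbol\theta)=e(\boldsymbol\theta')$ and $\sigma(\boldsymbol\theta)=\sigma(\boldsymbol\theta')$.
   Context: $\mathcal V$ is a finite word vocabulary, $\dashv$ is a sentence-boundary token, and $\widetilde{\mathcal V}=\mathcal V\cup\{\dashv\}$. $\mathrm{syl}:\mathcal V\to[1,s_{\max}]$ is a fixed bounded real-valued syllable count, extended by $\mathrm{syl}(\dashv)=0$. $\Delta^{m-1}$ is the probability simplex in $\mathbb R^m$. A token-exchangeable topic model consists of a document-level variable $\boldsymbol\theta\in\Delta^{K-1}$ with some prior and a map $\boldsymbol\theta\mapsto\pi_{\boldsymbol\theta}\in\Delta^{|\widetilde{\mathcal V}|-1}$ such that, given $\boldsymbol\theta$, the tokens $v_1,v_2,\dots$ are i.i.d. from $\pi_{\boldsymbol\theta}$. $e(\boldsymbol\theta)=\pi_{\boldsymbol\theta}(\dashv)$, $\sigma(\boldsymbol\theta)=\sum_{w\in\mathcal V}\pi_{\boldsymbol\theta}(w)\,\mathrm{syl}(w)$. Let $S_N=\sum_{n\le N}\mathbf 1[v_n=\dashv]$, $W_N=N-S_N$,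 $Y_N=\sum_{n\le N}\mathrm{syl}(v_n)$, and $\mathrm{FKGL}_N=a\,W_N/S_N+b\,Y_N/W_N+c$ (with an arbitrary fixed value when $S_N=0$ or $W_N=0$). The coefficients $(a,b,c)$ are fixed: $(0.39,11.8,-15.59)$ (Flesch–Kincaid Grade Level) or $(-1.015,-84.6,206.835)$ (Flesch Reading Ease). *)

(* Defs.v *)
(* MathComp world, with MathComp-Analysis over an abstract [R : realType]. *)
From HB Require Import structures.
From mathcomp Require Import all_boot all_order all_algebra.
From mathcomp Require Import all_classical all_reals all_analysis.

Set Implicit Arguments.
Unset Strict Implicit.
Unset Printing Implicit Defensive.

Import Order.TTheory GRing.Theory Num.Theory.
Import numFieldNormedType.Exports.

Local Open Scope classical_set_scope.
Local Open Scope ring_scope.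

(* Delta^(m-1) in R^m, with coordinates indexed by a finite type of size m. *)
Record simplex (R : realType) (I : finType) := Simplex {
  coord :> I -> R;
  coord_ge0 : forall i, 0 <= coord i;
  coord_sum1 : \sum_i coord i = 1
}.

Section TopicSimplex.
Variables (R : realType) (K : nat).

(* Measurable types of the library are pointed, hence nonempty: the number of
   topics, which is at least 1 since the simplex in R^0 is empty, is K.+1. *)
Definition topic_simplex := simplex R 'I_K.+1.

Let vertex_ge0 (i : 'I_K.+1) : 0 <= (i == ord0)%:R :> R.
Proof. exact: ler0n. Qed.

Let vertex_sum1 : \sum_(i < K.+1) (i == ord0)%:R = 1 :> R.
Proof. by rewrite (bigD1 ord0) //= big1 ?addr0 // => i /negbTE ->. Qed.

HB.instance Definition _ := gen_eqMixin topic_simplex.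
HB.instance Definition _ := gen_choiceMixin topic_simplex.
HB.instance Definition _ :=
  isPointed.Build topic_simplex (Simplex vertex_ge0 vertex_sum1).

Definition coordinate_sets : set (set topic_simplex) :=
  [set C | exists (i : 'I_K.+1) (B : set R),
    measurable B /\ C = [set t : topic_simplex | B (t i)]].

(* The sigma-algebra generated by the coordinates, i.e. the trace on the
   simplex of the Borel sigma-algebra of the ambient Euclidean space. *)
HB.instance Definition _ :=
  Measurable.copy topic_simplex (g_sigma_algebraType coordinate_sets).

End TopicSimplex.

(* Events involving a finite-valued variable are all its preimages, so [A j]
   ranges over arbitrary subsets of [T]. *)
Definition mutually_independent (R : realType) (disp : measure_display)
    (Omega : measurableType disp) (mu : set Omega -> \bar R)
    (T : finType) (X : nat -> Omega -> T) : Prop :=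
  forall (J : seq nat) (A : nat -> set T), uniq J ->
    mu (\bigcap_(j in [set` J]) (X j @^-1` A j)) =
    (\prod_(j <- J) mu (X j @^-1` A j))%E.

Definition iid_from (R : realType) (disp : measure_display)
    (Omega : measurableType disp) (mu : set Omega -> \bar R)
    (T : finType) (X : nat -> Omega -> T) (p : simplex R T) : Prop :=
  mutually_independent mu X /\
  (forall n x, mu (X n @^-1` [set x]) = (p x)%:E).

(* The vocabulary with sentence boundary is [option V], [None] being the
   boundary token. [token n] is the token v_(n+1). [cond_law] is the
   conditional law given theta, as a regular conditional probability, so that
   statements "given theta" make sense at each individual theta. *)
Record topic_model (R : realType) (V : finType) (K : nat)
    (disp : measure_display) (Omega : measurableType disp) := TopicModel {
  law : probability Omega R;
  theta : {mfun Omega >-> topic_simplex R K};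
  token : nat -> Omega -> option V;
  emission : topic_simplex R K -> simplex R (option V);
  cond_law : R.-pker (topic_simplex R K) ~> Omega;
  measurable_token : forall n v, measurable (token n @^-1` [set v]);
  cond_lawP : forall (A : set Omega) (B : set (topic_simplex R K)),
    measurable A -> measurable B ->
    law (A `&` theta @^-1` B) =
    (\int[distribution law theta]_(t in B) cond_law t A)%E;
  token_iid : forall t, iid_from (cond_law t) token (emission t)
}.

Section Readability.
Variables (R : realType) (V : finType).
Variable syl : V -> R.

Definition syl_ext (v : option V) : R := if v is Some w then syl w else 0.

Section Scores.
Variables (Omega : Type) (v : nat -> Omega -> option V).

Definition sentence_count (N : nat) (w : Omega) : R :=
  \sum_(n < N) (v n w == None)%:R.

Definition word_count (N : nat) (w : Omega) : R :=
  N%:R - sentence_count N w.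

Definition syllable_count (N : nat) (w : Omega) : R :=
  \sum_(n < N) syl_ext (v n w).

(* [d] is the fixed value used when there is no sentence or no word. *)
Definition fkgl (a b c d : R) (N : nat) (w : Omega) : R :=
  if (sentence_count N w == 0) || (word_count N w == 0) then d
  else a * (word_count N w / sentence_count N w)
       + b * (syllable_count N w / word_count N w) + c.

End Scores.

Variables (K : nat) (disp : measure_display) (Omega : measurableType disp).
Variable M : topic_model R V K Omega.

Definition boundary_prob (t : topic_simplex R K) : R := emission M t None.

Definition mean_syl (t : topic_simplex R K) : R :=
  \sum_(w : V) emission M t (Some w) * syl w.

Definition is_fkgl_limit (a b c d : R) (t : topic_simplex R K) (l : R) : Prop :=
  {ae cond_law M t, forall w,
    (fun N => fkgl (token M) a b c d N w) @ \oo --> l}.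

(* The almost sure limit; almost sure limits are unique since [cond_law M t]
   is a probability. *)
Definition Phi (a b c d : R) (t : topic_simplex R K) : R :=
  xget 0 [set l | is_fkgl_limit a b c d t l].

End Readability.

Definition g_limit (R : realType) (a b c u z : R) : R :=
  a * (1 - u) / u + b * z / (1 - u) + c.

(* (0.39, 11.8, -15.59) *)
Definition grade_level_coefs (R : realType) : R * R * R :=
  (39 / 100, 118 / 10, - (1559 / 100)).

(* (-1.015, -84.6, 206.835) *)
Definition reading_ease_coefs (R : realType) : R * R * R :=
  (- (1015 / 1000), - (846 / 10), 206 + 835 / 1000).

(* Main.v *)
(* Given theta, the number of occurrences of a token among the first N ones is
   binomial with parameter pi_theta(token); its fourth central moment is at most
   3 N^2, so by Markov's inequality deviations of order N have summable
   probabilities and Borel-Cantelli gives the strong law of large numbers. Sums of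
   a function of the tokens are linear combinations of such counts, hence
   S_N / N -> e and Y_N / N -> sigma almost surely, and the score is a continuous
   function of these two averages where 0 < e < 1. If e is 0 or 1, almost surely
   there is no boundary, respectively no word, and the score is the constant d. *)
Require Import Defs.
From HB Require Import structures.
From mathcomp Require Import all_boot all_order all_algebra.
From mathcomp Require Import all_classical all_reals all_analysis.
From mathcomp Require Import ring lra.

Set Implicit Arguments.
Unset Strict Implicit.
Unset Printing Implicit Defensive.

Import Order.TTheory GRing.Theory Num.Theory.
Import numFieldNormedType.Exports.

Local Open Scope classical_set_scope.
Local Open Scope ring_scope.

(** * Central moments of the binomial distribution, up to order four *)

Section binomial_moments.
Variables (R : realType) (p : R).

Lemma binomial_pmfS0 n : binomial_pmf n.+1 p 0 = (1 - p) * binomial_pmf n p 0.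
Proof. by rewrite /binomial_pmf !bin0 !subn0 !mulr1n !expr0 !mul1r exprS. Qed.

Lemma binomial_pmfSS n k : binomial_pmf n.+1 p k.+1 =
  p * binomial_pmf n p k + (1 - p) * binomial_pmf n p k.+1.
Proof.
rewrite /binomial_pmf subSS binS mulrnDr exprS /unstable.onem.
(* For [k >= n] the truncated exponent of [1 - p] does not matter, since the coefficient of that
   term vanishes. *)
have [kn|nk] := ltnP k n; last by rewrite (bin_small (m := k.+1)) ?ltnS // mulr0n; ring.
by rewrite -(subnSK kn) exprS; ring.
Qed.

Lemma binomial_pmf_gt n k : (n < k)%N -> binomial_pmf n p k = 0.
Proof. by move=> nk; rewrite /binomial_pmf bin_small. Qed.

(** Conditioning on the last trial. Every moment recursion below then reduces to a polynomial
    identity for each [k]. *)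
Lemma sum_binomial_pmfS n (h : nat -> R) :
  \sum_(k < n.+2) binomial_pmf n.+1 p k * h k =
  \sum_(k < n.+1) binomial_pmf n p k * (p * h k.+1 + (1 - p) * h k).
Proof.
have shift : \sum_(k < n.+1) binomial_pmf n p k * h k =
    binomial_pmf n p 0 * h 0%N +
    \sum_(k < n.+1) binomial_pmf n p k.+1 * h k.+1.
  have := @big_ord_recr _ 0 +%R n.+1 (fun k : 'I_n.+2 => binomial_pmf n p k * h k).
  by rewrite /= binomial_pmf_gt // mul0r addr0 => <-; rewrite big_ord_recl.
transitivity (p * (\sum_(k < n.+1) binomial_pmf n p k * h k.+1) +
              (1 - p) * \sum_(k < n.+1) binomial_pmf n p k * h k).
  rewrite shift big_ord_recl binomial_pmfS0 mulrDr addrCA mulrA; congr (_ + _).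
  rewrite !big_distrr -big_split /=; apply: eq_bigr => k _.
  by rewrite binomial_pmfSS; ring.
by rewrite !big_distrr -big_split /=; apply: eq_bigr => k _; ring.
Qed.

Definition central_moment (j n : nat) : R :=
  \sum_(k < n.+1) binomial_pmf n p k * (k%:R - n%:R * p) ^+ j.

Lemma central_moment0 n : central_moment 0 n = 1.
Proof.
elim: n => [|n IHn]; rewrite /central_moment.
  by rewrite big_ord1 /binomial_pmf bin0 !expr0 !mulr1.
rewrite (sum_binomial_pmfS _ (fun k => (k%:R - n.+1%:R * p) ^+ 0)) -[RHS]IHn.
by apply: eq_bigr => k _; rewrite !expr0; ring.
Qed.

Lemma central_moment1 n : central_moment 1 n = 0.
Proof.
elim: n => [|n IHn]; rewrite /central_moment.
  by rewrite big_ord1 mul0r subr0 expr1 mulr0.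
rewrite (sum_binomial_pmfS _ (fun k => (k%:R - n.+1%:R * p) ^+ 1)) -[RHS]IHn.
by apply: eq_bigr => k _; rewrite !expr1 -!natr1; ring.
Qed.

Lemma central_moment2 n : central_moment 2 n = n%:R * (p * (1 - p)).
Proof.
elim: n => [|n IHn].
  by rewrite /central_moment big_ord1 !mul0r subr0 expr0n mulr0.
transitivity (central_moment 2 n + p * (1 - p) * central_moment 0 n); last first.
  by rewrite central_moment0 IHn -natr1; ring.
rewrite /central_moment (sum_binomial_pmfS _ (fun k => (k%:R - n.+1%:R * p) ^+ 2)).
rewrite big_distrr -big_split /=.
by apply: eq_bigr => k _; rewrite expr0 -!natr1; ring.
Qed.

(** Expand [(D + x) ^+ 4], with [D] the centred count after [n] trials and [x] an independent
    centred Bernoulli variable: [x] has mean 0, second moment [p * (1 - p)], third moment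
    [p * (1 - p) * (1 - 2 * p)], and its fourth moment is the last summand. *)
Lemma central_moment4S n : central_moment 4 n.+1 =
  central_moment 4 n + 6 * (p * (1 - p)) ^+ 2 * n%:R +
  p * (1 - p) * (p ^+ 3 + (1 - p) ^+ 3).
Proof.
transitivity (central_moment 4 n + 6 * (p * (1 - p)) * central_moment 2 n +
    4 * (p * (1 - p) * (1 - 2 * p)) * central_moment 1 n +
    p * (1 - p) * (p ^+ 3 + (1 - p) ^+ 3) * central_moment 0 n); last first.
  by rewrite central_moment0 central_moment1 central_moment2; ring.
rewrite /central_moment (sum_binomial_pmfS _ (fun k => (k%:R - n.+1%:R * p) ^+ 4)).
rewrite !big_distrr -!big_split /=.
by apply: eq_bigr => k _; rewrite -!natr1; ring.
Qed.

(** Each step of the recursion adds at most [6 * n + 1], while the bound grows by [6 * n + 3]. *)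
Lemma central_moment4_le n : 0 <= p <= 1 -> central_moment 4 n <= 3 * n%:R ^+ 2.
Proof.
move=> /andP[p0 p1]; elim: n => [|n IHn].
  by rewrite /central_moment big_ord1 mul0r subr0 !expr0n !mulr0.
have n0 : 0 <= n%:R :> R by [].
have q0 : 0 <= p * (1 - p) by rewrite mulr_ge0 // subr_ge0.
have q1 : p * (1 - p) <= 1 by nra.
have qq1 : (p * (1 - p)) ^+ 2 <= 1 by rewrite exprn_ile1.
have c0 : 0 <= p ^+ 3 + (1 - p) ^+ 3.
  by rewrite addr_ge0 // exprn_ge0 // subr_ge0.
have c1 : p ^+ 3 + (1 - p) ^+ 3 <= 1 by nra.
have : (p * (1 - p)) ^+ 2 * n%:R <= n%:R by rewrite ler_piMl.
have : p * (1 - p) * (p ^+ 3 + (1 - p) ^+ 3) <= 1 by rewrite mulr_ile1.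
rewrite central_moment4S -natr1; move: IHn => /=; nra.
Qed.

End binomial_moments.

(** Comparison with a telescoping series: [1 / x ^+ 2 <= 2 / (x * (x + 1)) = 2 / x - 2 / (x + 1)]
    for [x >= 1]. *)
Lemma sum_inv_sqr_le (R : realFieldType) n :
  \sum_(0 <= k < n) (k.+1%:R ^+ 2)^-1 <= 2 :> R.
Proof.
apply: (@le_trans _ _ (\sum_(0 <= k < n) (- 2 / k.+2%:R - - 2 / k.+1%:R))).
  apply: ler_sum => k _.
  have k1 : 1 <= k.+1%:R :> R by rewrite ler1n.
  rewrite -[k.+2]addn1 natrD; move: (k.+1%:R : R) k1 => x x1.
  have -> : - 2 / (x + 1%:R) - - 2 / x = 2 / (x * (x + 1)).
    by field; apply/andP; split; rewrite gt_eqF //; lra.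
  rewrite ler_pdivlMr; last by nra.
  rewrite mulrC ler_pdivrMr; last by nra.
  by nra.
by rewrite telescope_sumr // divr1 opprK gerDr mulNr oppr_le0 divr_ge0.
Qed.

(** * Strong law of large numbers for i.i.d. variables with finitely many values *)

Section strong_law.
Context (R : realType) (d : measure_display) (Omega : measurableType d).
Variables (mu : {measure set Omega -> \bar R}) (T : finType).
Variables (X : nat -> Omega -> T) (p : simplex R T).
Hypothesis muT : mu setT = 1%E.
Hypothesis mX : forall n v, measurable (X n @^-1` [set v]).
Hypothesis Xiid : iid_from mu X p.

Lemma measurable_token_preimage n (C : set T) : measurable (X n @^-1` C).
Proof.
rewrite (_ : X n @^-1` C = \bigcup_(v in C) (X n @^-1` [set v])).
  by apply: fin_bigcup_measurable => [|v _]; [exact: finite_finset|exact: mX].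
by apply/seteqP; split=> [w Cw|w [v Cv /= ->] //]; exists (X n w).
Qed.

Definition hits (v : T) (N : nat) (w : Omega) : nat := \sum_(n < N) (X n w == v).

Lemma hitsS v N w : hits v N.+1 w = (hits v N w + (X N w == v))%N.
Proof. exact: big_ord_recr. Qed.

Lemma hits_leq v N w : (hits v N w <= N)%N.
Proof.
elim: N => [|N IHN]; first by rewrite /hits big_ord0.
by rewrite hitsS -addn1 leq_add ?leq_b1.
Qed.

Lemma hits_eq0 v N : [set w | hits v N.+1 w = 0%N] =
  [set w | hits v N w = 0%N] `&` X N @^-1` (~` [set v]).
Proof.
apply/seteqP; split=> w /=; rewrite hitsS.
  by case: eqP => [_|Xv] /=; rewrite ?addn1 ?addn0.
by move=> [-> /eqP/negbTE ->].
Qed.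

Lemma hits_eqS v N k : [set w | hits v N.+1 w = k.+1] =
  ([set w | hits v N w = k] `&` X N @^-1` [set v]) `|`
  ([set w | hits v N w = k.+1] `&` X N @^-1` (~` [set v])).
Proof.
apply/seteqP; split=> w /=; rewrite hitsS.
  by case: eqP => [->|Xv] /=; rewrite ?addn1 ?addn0; [move=> [<-]; left|move=> ->; right].
by move=> [[-> ->]|[-> /eqP/negbTE ->]]; rewrite ?eqxx ?addn1 ?addn0.
Qed.

Lemma measurable_hits v N k : measurable [set w | hits v N w = k].
Proof.
elim: N k => [|N IHN] k.
  by case: k => [|k]; [rewrite (_ : mkset _ = setT)|rewrite (_ : mkset _ = set0)] => //;
    apply/seteqP; split=> w //=; rewrite /hits big_ord0.
case: k => [|k].
  by rewrite hits_eq0; apply: measurableI => //; exact: measurable_token_preimage.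
by rewrite hits_eqS; apply: measurableU; apply: measurableI => //;
  exact: measurable_token_preimage.
Qed.

Lemma token_prob_setC n v : mu (X n @^-1` (~` [set v])) = (1 - p v)%:E.
Proof.
have mXv := mX n v.
have : (1 = (p v)%:E + mu (X n @^-1` (~` [set v])))%E.
  rewrite -muT -(Xiid.2 n v) -measureU //.
  - by rewrite -preimage_setC setUv.
  - exact: measurable_token_preimage.
  - by rewrite -preimage_setC setICr.
by case: (mu _) => //= r [e]; congr EFin; rewrite e; ring.
Qed.

Lemma simplex_coord01 v : 0 <= p v <= 1.
Proof.
rewrite coord_ge0 -(coord_sum1 p) (bigD1 v) //= lerDl sumr_ge0 // => i _.
exact: coord_ge0.
Qed.

(* Intersecting with an arbitrary event about tokens of index at least N makes the
   induction on N go through. *)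
Lemma hits_law_future v N k (J : seq nat) (A : nat -> set T) : uniq J ->
  (forall j, j \in J -> (N <= j)%N) ->
  mu ([set w | hits v N w = k] `&` \bigcap_(j in [set` J]) (X j @^-1` A j)) =
  ((binomial_pmf N (p v) k)%:E * \prod_(j <- J) mu (X j @^-1` A j))%E.
Proof.
elim: N k J A => [|N IHN] k J A uJ NJ.
  case: k => [|k].
    rewrite (_ : mkset _ = setT) ?setTI ?Xiid.1 //.
      by rewrite /binomial_pmf bin0 !expr0 mulr1 mul1e.
    by apply/seteqP; split=> w //=; rewrite /hits big_ord0.
  rewrite (_ : mkset _ = set0) ?set0I ?measure0 ?binomial_pmf_gt ?mul0e //.
  by apply/seteqP; split=> w //=; rewrite /hits big_ord0.
set B := \bigcap_(j in _) _.
have mB : measurable B.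
  by apply: bigcap_measurableType => j _; exact: measurable_token_preimage.
have step i C : mu ([set w | hits v N w = i] `&` X N @^-1` C `&` B) =
    ((binomial_pmf N (p v) i)%:E * (mu (X N @^-1` C) *
     \prod_(j <- J) mu (X j @^-1` A j)))%E.
  (* The constraint on token [N] joins the future event: [A'] extends [A] by [C] at the new index
     [N], and the induction hypothesis applies to [N :: J]. *)
  pose A' j := if j == N then C else A j.
  have NnJ : N \notin J by apply/negP => /NJ; rewrite ltnn.
  have A'N : A' N = C by rewrite /A' eqxx.
  have A'E j : j \in J -> A' j = A j.
    by move=> jJ; rewrite /A'; case: eqP => // jN; move: NnJ; rewrite -jN jJ.
  have -> : (\prod_(j <- J) mu (X j @^-1` A j) = \prod_(j <- J) mu (X j @^-1` A' j))%E.
    by apply: eq_big_seq => j jJ; rewrite A'E.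
  rewrite -[in RHS]A'N -(big_cons _ _ _ _ xpredT (fun j => mu (X j @^-1` A' j))) -IHN /=.
  - rewrite -setIA; congr (mu (_ `&` _)).
    apply/seteqP; split=> w /=.
      by move=> [Cw Bw] j /=; rewrite inE => /predU1P[->|jJ];
        rewrite /= ?A'N ?A'E //; exact: Bw.
    move=> A'w; split=> [|j jJ].
      by have := A'w N; rewrite /= A'N inE eqxx; exact.
    by have := A'w j; rewrite /= inE jJ orbT A'E //; exact.
  - by rewrite NnJ.
  - by move=> j; rewrite inE => /predU1P[-> //|/NJ/ltnW].
case: k => [|k].
  by rewrite hits_eq0 step token_prob_setC binomial_pmfS0 EFinM muleA (muleC (1 - _)%:E).
rewrite hits_eqS setIUl.
transitivity (mu ([set w | hits v N w = k] `&` X N @^-1` [set v] `&` B) +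
  mu ([set w | hits v N w = k.+1] `&` X N @^-1` (~` [set v]) `&` B))%E.
  apply: measureU.
  - by do 2! apply: measurableI => //; exact: measurable_hits.
  - apply: measurableI => //; apply: measurableI; first exact: measurable_hits.
    exact: measurable_token_preimage.
  - by apply/seteqP; split=> w //= [[[-> _] _] [[/eqP + _] _]]; rewrite ltn_eqF.
have /andP[p0 p1] := simplex_coord01 v.
have pmf0 i : 0 <= binomial_pmf N (p v) i by rewrite binomial_pmf_ge0 // p0.
rewrite !step Xiid.2 token_prob_setC !muleA -!EFinM -ge0_muleDl -?EFinD.
- by rewrite binomial_pmfSS; congr (_%:E * _)%E; ring.
- by rewrite lee_fin mulr_ge0.
- by rewrite lee_fin mulr_ge0 // subr_ge0.
Qed.

Lemma hits_law v N k :
  mu [set w | hits v N w = k] = (binomial_pmf N (p v) k)%:E.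
Proof.
have := @hits_law_future v N k [::] (fun=> setT) isT.
by rewrite set_nil bigcap_set0 setIT big_nil mule1; exact.
Qed.

Definition deviation_event v N (e : R) : set Omega :=
  [set w | e * N%:R <= `|(hits v N w)%:R - N%:R * p v|].

(** Values of [k] that do not deviate get the empty slice, so the union bound runs over the fixed
    range [k <= N]. *)
Definition deviation_slice v N (e : R) (k : nat) : set Omega :=
  if e * N%:R <= `|k%:R - N%:R * p v| then [set w | hits v N w = k] else set0.

Lemma measurable_deviation_slice v N e k : measurable (deviation_slice v N e k).
Proof. by rewrite /deviation_slice; case: ifP => _ //; exact: measurable_hits. Qed.

Lemma deviation_eventE v N e : deviation_event v N e =
  \big[setU/set0]_(k < N.+1) deviation_slice v N e k.
Proof.
rewrite -(bigcup_mkord N.+1 (deviation_slice v N e)) /deviation_slice.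
apply/seteqP; split=> w /=.
  by move=> we; exists (hits v N w); rewrite /= ?ltnS ?hits_leq ?we.
by move=> [k _]; case: ifP => // we /= wk; rewrite /deviation_event /= wk.
Qed.

Lemma measurable_deviation_event v N e : measurable (deviation_event v N e).
Proof.
rewrite deviation_eventE; apply: bigsetU_measurable => k _.
exact: measurable_deviation_slice.
Qed.

(* Markov's inequality for the fourth power of the deviation. *)
Lemma deviation_event_le v N e : 0 < e -> (0 < N)%N ->
  (mu (deviation_event v N e) <= (3 / e ^+ 4 / N%:R ^+ 2)%:E)%E.
Proof.
move=> e0 N0; have pv := simplex_coord01 v.
have eN0 : 0 < e * N%:R by rewrite mulr_gt0 ?ltr0n.
have eN4 : 0 < (e * N%:R) ^+ 4 by rewrite exprn_gt0.
rewrite deviation_eventE; apply: le_trans.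
  apply: (@Boole_inequality _ _ _ mu (deviation_slice v N e)) => k _.
  exact: measurable_deviation_slice.
(* On a nonempty slice the ratio of [(k - N p) ^+ 4] to [(e N) ^+ 4] is at least 1; weighting by the
   binomial law gives the fourth moment. *)
apply: (@le_trans _ _ (central_moment (p v) 4 N / (e * N%:R) ^+ 4)%:E).
  rewrite /central_moment mulr_suml -sumEFin; apply: lee_sum => k _.
  have pmf0 : 0 <= binomial_pmf N (p v) k by rewrite binomial_pmf_ge0.
  rewrite /deviation_slice; case: ifP => [ek|_]; last first.
    by rewrite measure0 lee_fin divr_ge0 ?(ltW eN4) // mulr_ge0 ?exprn_even_ge0.
  rewrite [leLHS](hits_law v N k) lee_fin -mulrA ler_peMr // ler_pdivlMr // mul1r.
  rewrite -[leRHS]ger0_norm ?exprn_even_ge0 // normrX.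
  by rewrite lerXn2r // ?nnegrE ?ltW.
rewrite lee_fin ler_pdivrMr // (le_trans (central_moment4_le _ pv)) //.
rewrite exprMn le_eqVlt; apply/orP; left; apply/eqP.
by field; rewrite ?pnatr_eq0 ?gt_eqF //= ?ltr0n.
Qed.

(** Borel-Cantelli, the probabilities being dominated by a multiple of the inverse squares. The
    shift to [n.+1] avoids the index 0, where the deviation event is the whole space. *)
Lemma deviation_limsup_eq0 v e : 0 < e ->
  mu (lim_sup_set (fun n => deviation_event v n.+1 e)) = 0%E.
Proof.
move=> e0; apply: lim_sup_set_cvg0 => [k|]; first exact: measurable_deviation_event.
apply: (@le_lt_trans _ _ (3 / e ^+ 4 * 2)%:E); last by rewrite ltry.
apply: lime_le; first by apply: is_cvg_nneseries.
apply: nearW => n.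
apply: (@le_trans _ _ (\sum_(0 <= k < n) (3 / e ^+ 4 / k.+1%:R ^+ 2)%:E)%E).
  by apply: lee_sum => k _; exact: deviation_event_le.
rewrite sumEFin lee_fin -mulr_sumr ler_wpM2l ?sum_inv_sqr_le //.
by rewrite divr_ge0 ?exprn_ge0 ?ltW.
Qed.

(** Only the countably many tolerances [m.+1%:R^-1] are used, so that the exceptional null sets have
    a null union. *)
Lemma hits_slln v :
  {ae mu, forall w, (fun N => (hits v N w)%:R / N%:R) @ \oo --> p v}.
Proof.
have : {ae mu, forall w, forall m : nat,
    exists n, forall N, (n <= N)%N -> ~ deviation_event v N.+1 m.+1%:R^-1 w}.
  apply: ae_foralln => m.
  exists (lim_sup_set (fun n => deviation_event v n.+1 m.+1%:R^-1)); split.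
  - apply: bigcapT_measurable => n; apply: bigcup_measurable => N _.
    exact: measurable_deviation_event.
  - by apply: deviation_limsup_eq0; rewrite invr_gt0.
  - move=> w /= /forallNP Hw n _; have /existsNP[N] := Hw n.
    by move=> /not_implyP[nN /contrapT dev]; exists N.
apply: filterS => w Hw; apply/cvgrPdist_lt => e e0.
have [m _ Hm] := near_infty_natSinv_lt (PosNum e0).
have [n Hn] := Hw m.
apply: near_inftyS; exists n => // N /= nN.
have /negP := Hn _ nN; rewrite -ltNge => dev.
have N0 : 0 < N.+1%:R :> R by [].
apply: le_lt_trans (Hm m (leqnn m)).
rewrite -(ler_pM2r N0) -[X in _ * X <= _]gtr0_norm // -normrM mulrBl.
by rewrite divfK ?gt_eqF // distrC (mulrC (p v)) ltW.
Qed.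

(** Grouping the sum by token value turns it into a finite linear combination of the counts, each of
    which obeys the strong law. *)
Lemma iid_slln (f : T -> R) :
  {ae mu, forall w, (fun N => (\sum_(n < N) f (X n w)) / N%:R) @ \oo -->
    \sum_v p v * f v}.
Proof.
have : {ae mu, forall w v, (fun N => (hits v N w)%:R / N%:R) @ \oo --> p v}.
  by apply: filter_forall => v; exact: hits_slln.
apply: filterS => w Hw.
rewrite (_ : (fun N => _) = fun N => \sum_v (hits v N w)%:R / N%:R * f v).
  by apply: cvg_big => [|v _]; [exact: add_continuous|apply: cvgMr_tmp; exact: Hw].
apply/funext => N.
transitivity (\sum_v (\sum_(n < N) (X n w == v)%:R * f v) / N%:R).
  rewrite -mulr_suml exchange_big; congr (_ / _); apply: eq_bigr => n _.
  rewrite (bigD1 (X n w)) //= eqxx mul1r big1 ?addr0 // => v /negbTE.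
  by rewrite eq_sym => ->; rewrite mul0r.
by apply: eq_bigr => v _; rewrite /hits natr_sum -mulr_suml mulrAC.
Qed.

End strong_law.

(** * Behaviour of the score along one fixed sequence of tokens *)

Section fkgl_limit.
Variables (R : realType) (V : finType) (syl : V -> R) (Omega : Type).
Variables (v : nat -> Omega -> option V) (a b c d : R) (w : Omega).

Lemma fkgl_cvg (e s : R) : 0 < e < 1 ->
  (fun N => sentence_count R v N w / N%:R) @ \oo --> e ->
  (fun N => syllable_count syl v N w / N%:R) @ \oo --> s ->
  (fun N => fkgl syl v a b c d N w) @ \oo --> g_limit a b c e s.
Proof.
move=> /andP[e0 e1] Se Ys.
set S := fun N => _ in Se; set Y := fun N => _ in Ys.
have We : (fun N => 1 - S N) @ \oo --> 1 - e by apply: cvgB => //; exact: cvg_cst.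
have SVe : (fun N => (S N)^-1) @ \oo --> e^-1 by apply: (cvgV _ Se); rewrite gt_eqF.
have WVe : (fun N => (1 - S N)^-1) @ \oo --> (1 - e)^-1.
  by apply: (cvgV _ We); rewrite gt_eqF // subr_gt0.
rewrite /g_limit -!mulrA.
have lim : (fun N => a * ((1 - S N) / S N) + b * (Y N / (1 - S N)) + c) @ \oo -->
    a * ((1 - e) / e) + b * (s / (1 - e)) + c.
  exact: cvgD (cvgD (cvgMl_tmp (cvgM We SVe)) (cvgMl_tmp (cvgM Ys WVe))) (cvg_cst c).
apply: cvg_trans; last exact: lim.
(* Eventually the boundary frequency lies strictly between 0 and 1; then the default branch of
   [fkgl] is not taken and the factor [N] cancels in both ratios. *)
apply: near_eq_cvg; near=> N.
have S0 : 0 < S N by near: N; exact: cvgr_gt Se _ e0.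
have S1 : S N < 1 by near: N; exact: cvgr_lt Se _ e1.
(* Division by zero yields 0, so a positive frequency excludes [N = 0]. *)
have N0 : N%:R != 0 :> R by apply: contraTneq S0 => N0; rewrite /S N0 invr0 mulr0 ltxx.
have SE : sentence_count R v N w = S N * N%:R by rewrite /S divfK.
have YE : syllable_count syl v N w = Y N * N%:R by rewrite /Y divfK.
have W0 : 1 - S N != 0 by rewrite gt_eqF // subr_gt0.
have WE : word_count R v N w = (1 - S N) * N%:R.
  by rewrite /word_count SE mulrBl mul1r.
rewrite /fkgl WE SE YE !(mulf_eq0 _ N%:R) (negbTE N0) (negbTE W0) (gt_eqF S0) /=.
by rewrite -!mulf_div divff // !mulr1.
Unshelve. all: by end_near. Qed.

Lemma fkgl_no_boundary N : (forall n, v n w != None) -> fkgl syl v a b c d N w = d.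
Proof.
move=> vN; rewrite /fkgl /sentence_count big1 ?eqxx // => n _.
by rewrite (negbTE (vN n)).
Qed.

Lemma fkgl_only_boundary N : (forall n, v n w = None) -> fkgl syl v a b c d N w = d.
Proof.
move=> vN; rewrite /fkgl /word_count /sentence_count.
have -> : \sum_(n < N) (v n w == None)%:R = N%:R :> R.
  rewrite (eq_bigr (fun=> 1)) => [|n _]; last by rewrite vN eqxx.
  by rewrite sumr_const card_ord.
by rewrite subrr eqxx orbT.
Qed.

End fkgl_limit.

(** * Almost sure limit of the score given the topic vector *)

Section topic_model_limit.
Variables (R : realType) (V : finType) (K : nat) (syl : V -> R) (a b c d : R).
Variables (disp : measure_display) (Omega : measurableType disp).
Variable M : topic_model R V K Omega.
Variable t : topic_simplex R K.

Let muT : cond_law M t setT = 1%E.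
Proof. exact: prob_kernel. Qed.

Let mtoken := measurable_token M.
Let iid_token := token_iid M t.

(** The conditional law has mass 1, so two almost sure events share an outcome, and limits of real
    sequences are unique there. *)
Lemma Phi_unique l : is_fkgl_limit syl M a b c d t l -> Phi syl M a b c d t = l.
Proof.
move=> Ml; apply: xget_unique => // l' Ml'.
have PF : ProperFilter (almost_everywhere (cond_law M t)).
  by apply: ae_properfilter_algebraOfSetsType; rewrite muT.
have [w [/= wl wl']] := filter_ex (filterI Ml Ml').
by rewrite -(cvg_lim _ wl) // -(cvg_lim _ wl').
Qed.

Lemma is_fkgl_limit_g : 0 < boundary_prob M t < 1 ->
  is_fkgl_limit syl M a b c d t
    (g_limit a b c (boundary_prob M t) (mean_syl syl M t)).
Proof.
move=> e01.
have := iid_slln muT mtoken iid_token (fun x => (x == None)%:R).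
have -> : \sum_x emission M t x * (x == None)%:R = boundary_prob M t.
  by rewrite (bigD1 None) //= mulr1 big1 ?addr0 // => x /negbTE ->; rewrite mulr0.
have := iid_slln muT mtoken iid_token (syl_ext syl).
have -> : \sum_x emission M t x * syl_ext syl x = mean_syl syl M t.
  (* The boundary token has no syllables, so only the words contribute to the mean. *)
  rewrite (bigD1 None) //= mulr0 add0r (reindex_omap Some id) /=; last by case.
  by apply: eq_bigl => x; rewrite eqxx.
by apply: filterS2 => w Ys Se; exact: fkgl_cvg.
Qed.

(** Covers the boundary probabilities 0 and 1: countably many almost sure conditions, one per token,
    hold together, and then every score takes the default value. *)
Lemma is_fkgl_limit_degenerate : ~~ (0 < boundary_prob M t < 1) ->
  is_fkgl_limit syl M a b c d t d.
Proof.
have /andP[e0 e1] := simplex_coord01 (emission M t) None.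
rewrite negb_and -!leNgt => /orP[e_le0|e_ge1].
- have {e0 e1 e_le0}e0 : emission M t None = 0 by apply/eqP; rewrite eq_le e0 andbT.
  have : {ae cond_law M t, forall w n, token M n w != None}.
    apply: ae_foralln => n; exists (token M n @^-1` [set None]); split => //.
      by rewrite iid_token.2 e0.
    by move=> w /= /negP; rewrite negbK => /eqP.
  apply: filterS => w Mw; rewrite (_ : (fun N => _) = fun=> d); first exact: cvg_cst.
  by apply/funext => N; exact: fkgl_no_boundary.
- have {e0 e1 e_ge1}e1 : emission M t None = 1 by apply/eqP; rewrite eq_le e1.
  have : {ae cond_law M t, forall w n, token M n w = None}.
    apply: ae_foralln => n; exists (token M n @^-1` (~` [set None])); split => //.
    + exact: measurable_token_preimage mtoken _ _.
    + by rewrite (token_prob_setC muT mtoken iid_token) e1 subrr.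
  apply: filterS => w Mw; rewrite (_ : (fun N => _) = fun=> d); first exact: cvg_cst.
  by apply/funext => N; exact: fkgl_only_boundary.
Qed.

End topic_model_limit.

Theorem corollary6 (R : realType) (V : finType) (K : nat)
  (smax : R) (syl : V -> R) (hsyl : forall w, 1 <= syl w <= smax)
  (a b c d : R)
  (habc : (a, b, c) = grade_level_coefs R \/ (a, b, c) = reading_ease_coefs R)
  (disp : measure_display) (Omega : measurableType disp)
  (M : topic_model R V K Omega) :
  (forall t : topic_simplex R K,
     0 < boundary_prob M t < 1 ->
     is_fkgl_limit syl M a b c d t (Phi syl M a b c d t) /\
     Phi syl M a b c d t =
       g_limit a b c (boundary_prob M t) (mean_syl syl M t)) /\
  (forall t t' : topic_simplex R K,
     boundary_prob M t = boundary_prob M t' ->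
     mean_syl syl M t = mean_syl syl M t' ->
     Phi syl M a b c d t = Phi syl M a b c d t').
Proof.
have PhiE t : 0 < boundary_prob M t < 1 -> Phi syl M a b c d t =
    g_limit a b c (boundary_prob M t) (mean_syl syl M t).
  by move=> e01; apply: Phi_unique; exact: is_fkgl_limit_g.
split=> [t e01|t t' ee ss]; first by rewrite PhiE //; split=> //; exact: is_fkgl_limit_g.
(* The second claim also allows boundary probability 0 or 1. Equal probabilities put [t] and [t'] in
   the same regime; in the degenerate one both limits are [d]. *)
have [e01|e01] := boolP (0 < boundary_prob M t < 1).
  by rewrite !PhiE -?ee // ss.
by rewrite !(Phi_unique (l := d)) //; apply: is_fkgl_limit_degenerate; rewrite -?ee.
Qed.
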